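(* The general vector field which describes the algebra of infinitesimal symmetries associated to the Liouville-\c{T}i\c{t}eica PDE $$\omega_{uv}=e^{\omega}$$ (for an unknown function $\omega=\omega(u,v)$) is $$W=f\frac{\partial}{\partial u}+g\frac{\partial}{\partial v}-(f'+g')\frac{\partial}{\partial\omega},$$ where $f=f(u)$ and $g=g(v)$ are arbitrary smooth functions.
   Context: Subscripts $u,v$ denote partial derivatives and primes denote derivatives of functions of one variable. An infinitesimal symmetry of a second order PDE $\Delta(u,v,\omega^{(2)})=0$ (where $\omega^{(2)}$ denotes $\omega$ and its partial derivatives up to order $2$) is a smooth vector field $X=\zeta(u,v,\omega)\frac{\partial}{\partial u}+\eta(u,v,\omega)\frac{\partial}{\partial v}+\phi(u,v,\omega)\frac{\partial}{\partial\omega}$ such that $\mathrm{pr}^{(2)}X[\Delta]=0$ whenever $\Delta=0$. Here $\mathrm{pr}^{(2)}X=X+\sum_J\phi^J\frac{\partial}{\partial\omega_J}$ over $J\in\{u,v,uu,uv,vv\}$, with $\phi^J=D_J(\phi-\zeta\omega_u-\eta\omega_v)+\zeta\omega_{J,u}+\eta\omega_{J,v}$ and $D_J$ the total derivative; $\omega_{J,u}$, $\omega_{J,v}$ denote the further derivatives of $\omega_J$. *)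

(* Defs.v *)
From Stdlib Require Import Reals List PeanoNat.
From Coquelicot Require Import Coquelicot.
Import ListNotations.
Open Scope R_scope.

(** * Jet space *)

(* [W i j] is the jet coordinate obtained from omega by differentiating i times
   in u and j times in v; [W 0 0] is omega itself. *)
Inductive coord : Set :=
| U : coord
| V : coord
| W : nat -> nat -> coord.

Definition coord_eq_dec (c d : coord) : {c = d} + {c <> d}.
Proof. decide equality; apply Nat.eq_dec. Defined.

(* Jets of all orders are carried along; a function of order n is one that reads
   only U, V and the W i j with i + j <= n. *)
Definition jet : Type := coord -> R.

Definition update (p : jet) (c : coord) (t : R) : jet :=
  fun d => if coord_eq_dec d c then t else p d.

Definition partial (c : coord) (F : jet -> R) : jet -> R :=
  fun p => Derive (fun t => F (update p c t)) (p c).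

Definition Rsum {A : Type} (l : list A) (a : A -> R) : R :=
  fold_right Rplus 0 (map a l).

Definition order12 : list (nat * nat) := [(1, 0); (0, 1); (2, 0); (1, 1); (0, 2)]%nat.
Definition order012 : list (nat * nat) := (0, 0)%nat :: order12.

(* Total derivatives. The sum over all W i j is cut off at i + j <= 2, which is
   exact on functions of order at most 2; below they are applied to functions of
   order 1 and to total derivatives of such functions. *)
Definition Du (F : jet -> R) : jet -> R :=
  fun p => partial U F p
    + Rsum order012 (fun J => let (i, j) := J in p (W (S i) j) * partial (W i j) F p).

Definition Dv (F : jet -> R) : jet -> R :=
  fun p => partial V F p
    + Rsum order012 (fun J => let (i, j) := J in p (W i (S j)) * partial (W i j) F p).

Definition DJ (J : nat * nat) (F : jet -> R) : jet -> R :=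
  let (i, j) := J in Nat.iter i Du (Nat.iter j Dv F).

(** * Smoothness *)

Definition smooth (f : R -> R) : Prop := forall n x, ex_derive_n f n x.

Inductive var3 : Set := X1 | X2 | X3.

Definition ex_partial3 (i : var3) (F : R -> R -> R -> R) (x y z : R) : Prop :=
  match i with
  | X1 => ex_derive (fun t => F t y z) x
  | X2 => ex_derive (fun t => F x t z) y
  | X3 => ex_derive (fun t => F x y t) z
  end.

Definition partial3 (i : var3) (F : R -> R -> R -> R) : R -> R -> R -> R :=
  fun x y z =>
  match i with
  | X1 => Derive (fun t => F t y z) x
  | X2 => Derive (fun t => F x t z) y
  | X3 => Derive (fun t => F x y t) z
  end.

(* All iterated partial derivatives, in any order of differentiation, exist and
   are jointly continuous. *)
Definition smooth3 (F : R -> R -> R -> R) : Prop :=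
  forall (l : list var3) (x y z : R),
    let G := fold_right partial3 F l in
    continuous (fun q : R * R * R => G (fst (fst q)) (snd (fst q)) (snd q)) (x, y, z)
    /\ forall i : var3, ex_partial3 i G x y z.

(** * Vector fields, second prolongation, infinitesimal symmetries *)

Record vector_field : Type := VectorField {
  zeta : R -> R -> R -> R;
  eta : R -> R -> R -> R;
  phi : R -> R -> R -> R
}.

Definition smooth_vector_field (X : vector_field) : Prop :=
  smooth3 (zeta X) /\ smooth3 (eta X) /\ smooth3 (phi X).

Definition lift (F : R -> R -> R -> R) : jet -> R :=
  fun p => F (p U) (p V) (p (W 0 0)).

Definition characteristic (X : vector_field) : jet -> R :=
  fun p => lift (phi X) p - lift (zeta X) p * p (W 1 0) - lift (eta X) p * p (W 0 1).

Definition phiJ (X : vector_field) (J : nat * nat) : jet -> R :=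
  fun p => let (i, j) := J in
    DJ J (characteristic X) p
    + lift (zeta X) p * p (W (S i) j) + lift (eta X) p * p (W i (S j)).

Definition pr2 (X : vector_field) (Delta : jet -> R) : jet -> R :=
  fun p =>
    lift (zeta X) p * partial U Delta p
    + lift (eta X) p * partial V Delta p
    + lift (phi X) p * partial (W 0 0) Delta p
    + Rsum order12 (fun J => let (i, j) := J in phiJ X J p * partial (W i j) Delta p).

(* [Delta] is meant to be of order at most 2. The coefficients [phiJ] are written
   with coordinates of order 3, which cancel, so quantifying over all jets is the
   same as quantifying over 2-jets. *)
Definition infinitesimal_symmetry (Delta : jet -> R) (X : vector_field) : Prop :=
  smooth_vector_field X /\ forall p : jet, Delta p = 0 -> pr2 X Delta p = 0.

Definition liouville_titeica : jet -> R :=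
  fun p => p (W 1 1) - exp (p (W 0 0)).

(* Main.v *)
Require Import Defs.
From Stdlib Require Import Reals List Lra FunctionalExtensionality.
From Coquelicot Require Import Coquelicot.
Open Scope R_scope.

(** Only the coefficient [phi^{uv}] enters the symmetry condition. On the equation
    it is a polynomial in the free jet coordinates [omega_u], [omega_v],
    [omega_uu], [omega_vv], so its coefficients vanish separately. Those of
    [omega_uu] and [omega_vv] give [zeta = f u] and [eta = g v]; the others make
    [phi] affine in [omega], with [phi_uv] independent of [omega], and leave
    [phi_uv = e^omega (f' + g' + phi - phi_omega)], which forces
    [phi = - (f' + g')]. *)

(** * Elementary facts in one real variable *)

Lemma Derive_zero_constant (f : R -> R) :
  (forall x, ex_derive f x) -> (forall x, Derive f x = 0) -> forall x y, f x = f y.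
Proof.
  intros Hf H0 x y.
  destruct (MVT_gen f x y (Derive f)) as [c [_ Hc]].
  - intros z _. apply Derive_correct, Hf.
  - intros z _. apply continuity_pt_filterlim, (ex_derive_continuous f), Hf.
  - rewrite H0 in Hc. lra.
Qed.

(** Three sample points suffice. With [e = exp 1], the values at 0, 1 and -1 give [k = m],
    [k = e * (m + c)] and [e * k = m - c]; eliminating [k] and [c] leaves [m * (e - 1)^2 = 0], and
    [e > 2]. *)
Lemma affine_exp_constant (m c k : R) :
  (forall w, k = exp w * (m + c * w)) -> m = 0 /\ c = 0.
Proof.
  intros H.
  pose proof (H 0) as H0. rewrite exp_0 in H0.
  pose proof (H 1) as H1. pose proof (H (- (1))) as H2.
  rewrite exp_Ropp in H2.
  pose proof (exp_ineq1 1 ltac:(lra)) as He.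
  set (e := exp 1) in *.
  assert (Hc : c = m * (1 - e)).
  { assert (e * k = m - c) by (rewrite H2; field; lra). nra. }
  assert (Hm : m * (e - 1) * (e - 1) = 0) by (subst c; nra).
  apply Rmult_integral in Hm. destruct Hm as [Hm | Hm]; [| lra].
  apply Rmult_integral in Hm. destruct Hm as [Hm | Hm]; [| lra].
  split; [exact Hm | rewrite Hc, Hm; ring].
Qed.

(** * Smooth functions of three variables *)

(** The last entry of the list is the innermost derivative, so differentiating [partial3 i F] along
    [l] is differentiating [F] along [l] with [i] appended. *)
Lemma smooth3_partial3 (i : var3) (F : R -> R -> R -> R) :
  smooth3 F -> smooth3 (partial3 i F).
Proof.
  intros HF l x y z. generalize (HF (l ++ i :: nil)%list x y z).
  rewrite fold_right_app. exact (fun H => H).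
Qed.

Lemma smooth3_ex_partial3 (i : var3) (F : R -> R -> R -> R) (x y z : R) :
  smooth3 F -> ex_partial3 i F x y z.
Proof. intros HF. apply (HF nil x y z). Qed.

Lemma smooth3_section1 (F : R -> R -> R -> R) (y z : R) :
  smooth3 F -> smooth (fun x => F x y z).
Proof.
  intros HF n.
  assert (HD : forall m x, Derive_n (fun t => F t y z) m x
                 = fold_right partial3 F (repeat X1 m) x y z).
  { induction m as [|m IH]; intros x; [reflexivity |].
    apply Derive_ext; exact IH. }
  (* Order 0 asks for nothing; order [S n] asks that the derivative of order [n] be
     differentiable. *)
  destruct n as [|n]; intros x; [exact I |].
  apply (ex_derive_ext (fun t => fold_right partial3 F (repeat X1 n) t y z)).
  - intros t. symmetry. apply HD.
  - apply (HF (repeat X1 n) x y z) with (i := X1).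
Qed.

Lemma smooth3_section2 (F : R -> R -> R -> R) (x z : R) :
  smooth3 F -> smooth (fun y => F x y z).
Proof.
  intros HF n.
  assert (HD : forall m y, Derive_n (fun t => F x t z) m y
                 = fold_right partial3 F (repeat X2 m) x y z).
  { induction m as [|m IH]; intros y; [reflexivity |].
    apply Derive_ext; exact IH. }
  destruct n as [|n]; intros y; [exact I |].
  apply (ex_derive_ext (fun t => fold_right partial3 F (repeat X2 n) x t z)).
  - intros t. symmetry. apply HD.
  - apply (HF (repeat X2 n) x y z) with (i := X2).
Qed.

Lemma smooth_ex_derive (f : R -> R) (x : R) : smooth f -> ex_derive f x.
Proof. intros Hf. exact (Hf 1%nat x). Qed.

Lemma smooth_Derive (f : R -> R) : smooth f -> smooth (Derive f).
Proof.
  intros Hf n x. destruct n as [|n]; [exact I |].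
  apply (ex_derive_ext (Derive_n f (S n))).
  - intros t. rewrite <- (Nat.add_1_r n), <- (Derive_n_comp f n 1). reflexivity.
  - exact (Hf (S (S n)) x).
Qed.

Lemma smooth_const (c : R) : smooth (fun _ => c).
Proof. intros n x. apply ex_derive_n_const. Qed.

Lemma smooth_opp (f : R -> R) : smooth f -> smooth (fun x => - f x).
Proof. intros Hf n x. apply ex_derive_n_opp, Hf. Qed.

(** Sums of a function of [x] and a function of [y] are closed under all three partial derivatives,
    so every iterated partial has this form again. The coefficients of the general symmetry are all
    of this kind. *)
Lemma smooth3_separated (f g : R -> R) :
  smooth f -> smooth g -> smooth3 (fun x y _ => f x + g y).
Proof.
  intros Hf Hg l x y z.
  assert (Hl : exists f1 g1, smooth f1 /\ smooth g1 /\
    fold_right partial3 (fun x y _ => f x + g y) l = (fun x y _ => f1 x + g1 y)).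
  { induction l as [|i l [f1 [g1 [Hf1 [Hg1 E]]]]].
    - exists f, g. auto.
    - simpl. rewrite E. destruct i.
      + exists (Derive f1), (fun _ => 0).
        repeat split; [now apply smooth_Derive | apply smooth_const |].
        do 3 (apply functional_extensionality; intros ?). simpl.
        rewrite Derive_plus, Derive_const; [reflexivity | | apply ex_derive_const].
        now apply smooth_ex_derive.
      + exists (fun _ => 0), (Derive g1).
        repeat split; [apply smooth_const | now apply smooth_Derive |].
        do 3 (apply functional_extensionality; intros ?). simpl.
        rewrite Derive_plus, Derive_const; [reflexivity | apply ex_derive_const |].
        now apply smooth_ex_derive.
      + exists (fun _ => 0), (fun _ => 0).
        repeat split; [apply smooth_const | apply smooth_const |].
        do 3 (apply functional_extensionality; intros ?). simpl.
        rewrite Derive_const. ring. }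
  destruct Hl as [f1 [g1 [Hf1 [Hg1 E]]]]. simpl. rewrite E. split.
  - apply (continuous_plus (fun q : R * R * R => f1 (fst (fst q)))
                           (fun q : R * R * R => g1 (snd (fst q)))).
    + apply (continuous_comp (fun q : R * R * R => fst (fst q)) f1).
      * apply (continuous_comp (@fst (R * R) R) fst); apply continuous_fst.
      * apply (ex_derive_continuous f1). now apply smooth_ex_derive.
    + apply (continuous_comp (fun q : R * R * R => snd (fst q)) g1).
      * apply (continuous_comp (@fst (R * R) R) snd);
          [apply continuous_fst | apply continuous_snd].
      * apply (ex_derive_continuous g1). now apply smooth_ex_derive.
  - intros [| |]; simpl.
    + apply (ex_derive_plus (V := R_NormedModule) f1 (fun _ => g1 y));
        [now apply smooth_ex_derive | apply ex_derive_const].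
    + apply (ex_derive_plus (V := R_NormedModule) (fun _ => f1 x) g1);
        [apply ex_derive_const | now apply smooth_ex_derive].
    + apply ex_derive_const.
Qed.

(** * Total derivatives as directional derivatives *)

(** The derivative of [F] at [p] in the direction [q], with the same cut-off at order 2 as [Du] and
    [Dv]. Differentiability in each coordinate is carried along so that the sum and product rules
    compose. *)
Definition is_dir (q : jet) (F : jet -> R) (p : jet) (l : R) : Prop :=
  (forall c, ex_derive (fun t => F (update p c t)) (p c)) /\
  q U * partial U F p + q V * partial V F p
  + Rsum order012 (fun J => let (i, j) := J in q (W i j) * partial (W i j) F p) = l.

(** The direction whose directional derivative is the total derivative in [u]: each jet coordinate
    moves at the rate of its own [u]-derivative. *)
Definition shift_u (p : jet) : jet := fun c =>
  match c with U => 1 | V => 0 | W i j => p (W (S i) j) end.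

Definition shift_v (p : jet) : jet := fun c =>
  match c with U => 0 | V => 1 | W i j => p (W i (S j)) end.

Lemma is_dir_Du (F : jet -> R) (p : jet) (l : R) :
  is_dir (shift_u p) F p l -> Du F p = l.
Proof. intros [_ <-]. unfold Du, Rsum; simpl. ring. Qed.

Lemma is_dir_Dv (F : jet -> R) (p : jet) (l : R) :
  is_dir (shift_v p) F p l -> Dv F p = l.
Proof. intros [_ <-]. unfold Dv, Rsum; simpl. ring. Qed.

Lemma update_id (p : jet) (c : coord) : update p c (p c) = p.
Proof.
  apply functional_extensionality; intros d. unfold update.
  destruct (coord_eq_dec d c); congruence.
Qed.

Lemma is_dir_plus (q : jet) (F G : jet -> R) (p : jet) (l m : R) :
  is_dir q F p l -> is_dir q G p m -> is_dir q (fun p => F p + G p) p (l + m).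
Proof.
  intros [HF <-] [HG <-].
  assert (E : forall c, partial c (fun p => F p + G p) p = partial c F p + partial c G p).
  { intros c. apply (Derive_plus (fun t => F (update p c t)) (fun t => G (update p c t)));
      [apply HF | apply HG]. }
  split.
  - intros c. apply (ex_derive_plus (V := R_NormedModule)
      (fun t => F (update p c t)) (fun t => G (update p c t))); [apply HF | apply HG].
  - unfold Rsum; simpl. rewrite !E. ring.
Qed.

Lemma is_dir_minus (q : jet) (F G : jet -> R) (p : jet) (l m : R) :
  is_dir q F p l -> is_dir q G p m -> is_dir q (fun p => F p - G p) p (l - m).
Proof.
  intros [HF <-] [HG <-].
  assert (E : forall c, partial c (fun p => F p - G p) p = partial c F p - partial c G p).
  { intros c. apply (Derive_minus (fun t => F (update p c t)) (fun t => G (update p c t)));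
      [apply HF | apply HG]. }
  split.
  - intros c. apply (ex_derive_minus (V := R_NormedModule)
      (fun t => F (update p c t)) (fun t => G (update p c t))); [apply HF | apply HG].
  - unfold Rsum; simpl. rewrite !E. ring.
Qed.

Lemma is_dir_mult (q : jet) (F G : jet -> R) (p : jet) (l m : R) :
  is_dir q F p l -> is_dir q G p m ->
  is_dir q (fun p => F p * G p) p (l * G p + F p * m).
Proof.
  intros [HF <-] [HG <-].
  assert (E : forall c, partial c (fun p => F p * G p) p
                        = partial c F p * G p + F p * partial c G p).
  { intros c. unfold partial at 1.
    rewrite (Derive_mult (fun t => F (update p c t)) (fun t => G (update p c t)));
      [| apply HF | apply HG].
    (* The product rule leaves the undifferentiated factors at [update p c (p c)], which is [p]. *)
    rewrite update_id. reflexivity. }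
  split.
  - intros c. apply (ex_derive_mult
      (fun t => F (update p c t)) (fun t => G (update p c t))); [apply HF | apply HG].
  - unfold Rsum; simpl. rewrite !E. ring.
Qed.

(** The membership hypothesis reflects the cut-off: a coordinate of order 3 or more would contribute
    0 to the sum. *)
Lemma is_dir_coord (q : jet) (i j : nat) (p : jet) :
  List.In (i, j) order012 -> is_dir q (fun p => p (W i j)) p (q (W i j)).
Proof.
  intros Hij.
  assert (E : forall c, is_derive (fun t => update p c t (W i j)) (p c)
                          (if coord_eq_dec (W i j) c then 1 else 0)).
  { intros c. unfold update. destruct (coord_eq_dec (W i j) c).
    - apply (is_derive_id (K := R_AbsRing)).
    - apply (is_derive_const (K := R_AbsRing) (V := R_NormedModule)). }
  split.
  - intros c. eexists. apply E.
  - assert (E' : forall c, partial c (fun p => p (W i j)) p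
                           = if coord_eq_dec (W i j) c then 1 else 0).
    { intros c. apply is_derive_unique, E. }
    unfold Rsum; simpl. rewrite !E'.
    repeat (destruct Hij as [Hij | Hij]; [injection Hij as <- <-; simpl; ring |]).
    destruct Hij.
Qed.

(** The chain rule for a function that reads only [u], [v] and [omega]; the partials in all other
    jet coordinates vanish. *)
Lemma is_dir_lift (q : jet) (F : R -> R -> R -> R) (p : jet) :
  smooth3 F ->
  is_dir q (lift F) p
    (q U * lift (partial3 X1 F) p + q V * lift (partial3 X2 F) p
     + q (W 0 0) * lift (partial3 X3 F) p).
Proof.
  intros HF.
  assert (E0 : forall i j, (i, j) <> (0, 0)%nat -> forall t,
            lift F (update p (W i j) t) = lift F p).
  { intros i j Hij t. unfold lift, update.
    destruct (coord_eq_dec (W 0 0) (W i j)) as [E|]; [congruence | reflexivity]. }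
  split.
  - intros [| | i j].
    + apply (smooth3_ex_partial3 X1 F (p U) (p V) (p (W 0 0)) HF).
    + apply (smooth3_ex_partial3 X2 F (p U) (p V) (p (W 0 0)) HF).
    + destruct (coord_eq_dec (W i j) (W 0 0)) as [E|E].
      * injection E as -> ->.
        apply (smooth3_ex_partial3 X3 F (p U) (p V) (p (W 0 0)) HF).
      * apply (ex_derive_ext (fun _ => lift F p)); [| apply ex_derive_const].
        intros t. symmetry. apply E0. congruence.
  - assert (E1 : forall i j, (i, j) <> (0, 0)%nat -> partial (W i j) (lift F) p = 0).
    { intros i j Hij. unfold partial.
      rewrite (Derive_ext _ (fun _ => lift F p)); [apply Derive_const |].
      intros t. now apply E0. }
    unfold Rsum; simpl.
    rewrite (E1 1%nat 0%nat), (E1 0%nat 1%nat), (E1 2%nat 0%nat), (E1 1%nat 1%nat),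
      (E1 0%nat 2%nat) by congruence.
    change (partial U (lift F) p) with (lift (partial3 X1 F) p).
    change (partial V (lift F) p) with (lift (partial3 X2 F) p).
    change (partial (W 0 0) (lift F) p) with (lift (partial3 X3 F) p).
    ring.
Qed.

(** The shape of the function selects the rule, and the value of the derivative, left as an
    existential variable, is built up along the way. *)
Ltac is_dir_tac :=
  repeat match goal with
  | |- is_dir _ (fun p => p (W _ _)) _ _ => apply is_dir_coord; simpl; tauto
  | |- is_dir _ (fun p => _ + _) _ _ => eapply is_dir_plus
  | |- is_dir _ (fun p => _ - _) _ _ => eapply is_dir_minus
  | |- is_dir _ (fun p => _ * _) _ _ => eapply is_dir_mult
  | |- is_dir _ (lift _) _ _ => apply is_dir_lift
  | |- smooth3 (partial3 _ _) => apply smooth3_partial3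
  | |- smooth3 _ => assumption
  end.

(** * The symmetry condition *)

(** An equality of functions, since [Du] is applied to it next; the right side again consists of
    lifts and coordinates of order at most 2, so the same rules apply. *)
Lemma Dv_characteristic (X : vector_field) :
  smooth_vector_field X ->
  Dv (characteristic X) = fun p =>
    lift (partial3 X2 (phi X)) p
    + p (W 0 1) * lift (partial3 X3 (phi X)) p
    - p (W 1 0) * lift (partial3 X2 (zeta X)) p
    - p (W 0 1) * p (W 1 0) * lift (partial3 X3 (zeta X)) p
    - p (W 1 1) * lift (zeta X) p
    - p (W 0 1) * lift (partial3 X2 (eta X)) p
    - p (W 0 1) * p (W 0 1) * lift (partial3 X3 (eta X)) p
    - p (W 0 2) * lift (eta X) p.
Proof.
  intros [Hz [He Hp]]. apply functional_extensionality; intros p.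
  unfold characteristic. erewrite is_dir_Dv; [| is_dir_tac].
  simpl. ring.
Qed.

(** Mixed partials stay in the order in which the total derivatives produce them: in [L i j] the
    derivative [j] is taken first. *)
Lemma phiJ_uv (X : vector_field) (p : jet) :
  smooth_vector_field X ->
  phiJ X (1, 1)%nat p =
    let L i j F := lift (partial3 i (partial3 j F)) p in
    let P i F := lift (partial3 i F) p in
    let a := p (W 1 0) in let b := p (W 0 1) in
    let r := p (W 2 0) in let s := p (W 1 1) in let t := p (W 0 2) in
    L X1 X2 (phi X) + a * L X3 X2 (phi X) + b * L X1 X3 (phi X)
    + a * b * L X3 X3 (phi X) + s * P X3 (phi X)
    - a * (L X1 X2 (zeta X) + a * L X3 X2 (zeta X)) - r * P X2 (zeta X)
    - a * b * (L X1 X3 (zeta X) + a * L X3 X3 (zeta X))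
    - (s * a + b * r) * P X3 (zeta X)
    - s * (P X1 (zeta X) + a * P X3 (zeta X))
    - b * (L X1 X2 (eta X) + a * L X3 X2 (eta X)) - s * P X2 (eta X)
    - b * b * (L X1 X3 (eta X) + a * L X3 X3 (eta X)) - 2 * b * s * P X3 (eta X)
    - t * (P X1 (eta X) + a * P X3 (eta X)).
Proof.
  intros HX. unfold phiJ. simpl DJ. rewrite (Dv_characteristic X HX).
  destruct HX as [Hz [He Hp]].
  erewrite is_dir_Du; [| is_dir_tac].
  (* The third order coordinates [W 2 1] and [W 1 2] from differentiating [omega_uv] and [omega_vv]
     cancel against the last two terms of [phiJ]. *)
  simpl. ring.
Qed.

(** The equation involves only [omega_uv] and [omega], with partial derivatives 1 and
    [- exp omega]. *)
Lemma pr2_liouville_titeica (X : vector_field) (p : jet) :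
  pr2 X liouville_titeica p = phiJ X (1, 1)%nat p - lift (phi X) p * exp (p (W 0 0)).
Proof.
  unfold pr2, Rsum; simpl.
  assert (H0 : forall c, c <> W 1 1 -> c <> W 0 0 -> partial c liouville_titeica p = 0).
  { intros c H11 H00. unfold partial.
    rewrite (Derive_ext _ (fun _ => liouville_titeica p)); [apply Derive_const |].
    intros t. unfold liouville_titeica, update.
    destruct (coord_eq_dec (W 1 1) c), (coord_eq_dec (W 0 0) c); congruence. }
  assert (H1 : partial (W 1 1) liouville_titeica p = 1).
  { change (Derive (fun t => t - exp (p (W 0 0))) (p (W 1 1)) = 1).
    apply is_derive_unique. auto_derive; [exact I | ring]. }
  assert (H2 : partial (W 0 0) liouville_titeica p = - exp (p (W 0 0))).
  { change (Derive (fun t => p (W 1 1) - exp t) (p (W 0 0)) = - exp (p (W 0 0))).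
    apply is_derive_unique. auto_derive; [exact I | ring]. }
  rewrite H1, H2, !H0 by congruence. unfold phiJ; simpl. ring.
Qed.

(** * Determining equations for the coefficients of a symmetry *)

Definition jet_at (u v w a b r s t : R) : jet := fun c =>
  match c with
  | U => u | V => v
  | W 0 0 => w | W 1 0 => a | W 0 1 => b
  | W 2 0 => r | W 1 1 => s | W 0 2 => t
  | W _ _ => 0
  end.

Lemma symmetry_polynomial (X : vector_field) (u v w : R) :
  infinitesimal_symmetry liouville_titeica X ->
  forall a b r t : R,
    let L i j F := partial3 i (partial3 j F) u v w in
    let P i F := partial3 i F u v w in
    let s := exp w in
    L X1 X2 (phi X) + a * L X3 X2 (phi X) + b * L X1 X3 (phi X)
    + a * b * L X3 X3 (phi X) + s * P X3 (phi X)
    - a * (L X1 X2 (zeta X) + a * L X3 X2 (zeta X)) - r * P X2 (zeta X)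
    - a * b * (L X1 X3 (zeta X) + a * L X3 X3 (zeta X))
    - (s * a + b * r) * P X3 (zeta X)
    - s * (P X1 (zeta X) + a * P X3 (zeta X))
    - b * (L X1 X2 (eta X) + a * L X3 X2 (eta X)) - s * P X2 (eta X)
    - b * b * (L X1 X3 (eta X) + a * L X3 X3 (eta X)) - 2 * b * s * P X3 (eta X)
    - t * (P X1 (eta X) + a * P X3 (eta X))
    = phi X u v w * s.
Proof.
  intros [HX H] a b r t.
  (* Setting [omega_uv] to [exp w] puts the jet on the equation and leaves [a], [b], [r], [t]
     free. *)
  assert (K : pr2 X liouville_titeica (jet_at u v w a b r (exp w) t) = 0).
  { apply H. unfold liouville_titeica; simpl. ring. }
  rewrite pr2_liouville_titeica, (phiJ_uv X _ HX) in K.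
  exact (Rminus_diag_uniq _ _ K).
Qed.

Lemma symmetry_zeta_eta (X : vector_field) :
  infinitesimal_symmetry liouville_titeica X ->
  zeta X = (fun u _ _ => zeta X u 0 0) /\ eta X = (fun _ v _ => eta X 0 v 0).
Proof.
  intros H.
  assert (Z : forall u v w,
    partial3 X2 (zeta X) u v w = 0 /\ partial3 X3 (zeta X) u v w = 0 /\
    partial3 X1 (eta X) u v w = 0 /\ partial3 X3 (eta X) u v w = 0).
  { intros u v w. pose proof (symmetry_polynomial X u v w H) as K. cbv beta zeta in K.
    (* Differences in [r] at [b = 0] and [b = 1] isolate [zeta_v] and [zeta_v + zeta_omega];
       differences in [t] at [a = 0] and [a = 1] do the same for [eta_u] and [eta_u + eta_omega]. *)
    pose proof (K 0 0 0 0). pose proof (K 0 0 1 0). pose proof (K 0 1 0 0).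
    pose proof (K 0 1 1 0). pose proof (K 0 0 0 1). pose proof (K 1 0 0 0).
    pose proof (K 1 0 0 1).
    repeat split; lra. }
  destruct H as [[Hz [He _]] _].
  split; apply functional_extensionality; intros u;
    apply functional_extensionality; intros v;
    apply functional_extensionality; intros w.
  - transitivity (zeta X u v 0).
    + apply (Derive_zero_constant (fun t => zeta X u v t)); intros t;
        [apply (smooth3_ex_partial3 X3 _ u v t Hz) | apply (Z u v t)].
    + apply (Derive_zero_constant (fun t => zeta X u t 0)); intros t;
        [apply (smooth3_ex_partial3 X2 _ u t 0 Hz) | apply (Z u t 0)].
  - transitivity (eta X u v 0).
    + apply (Derive_zero_constant (fun t => eta X u v t)); intros t;
        [apply (smooth3_ex_partial3 X3 _ u v t He) | apply (Z u v t)].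
    + apply (Derive_zero_constant (fun t => eta X t v 0)); intros t;
        [apply (smooth3_ex_partial3 X1 _ t v 0 He) | apply (Z t v 0)].
Qed.

Lemma partial3_zero (i : var3) : partial3 i (fun _ _ _ => 0) = fun _ _ _ => 0.
Proof.
  do 3 (apply functional_extensionality; intros ?).
  destruct i; apply (Derive_const 0).
Qed.

(** Common to both directions of the classification: once [zeta] depends on [u] alone and [eta] on
    [v] alone, only [f'] and [g'] survive from them, both multiplied by [omega_uv]. *)
Lemma pr2_projectable (X : vector_field) (f g : R -> R) (p : jet) :
  smooth_vector_field X ->
  zeta X = (fun u _ _ => f u) -> eta X = (fun _ v _ => g v) ->
  pr2 X liouville_titeica p =
    let L i j := lift (partial3 i (partial3 j (phi X))) p in
    L X1 X2 + p (W 1 0) * L X3 X2 + p (W 0 1) * L X1 X3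
    + p (W 1 0) * p (W 0 1) * L X3 X3
    + p (W 1 1) * (lift (partial3 X3 (phi X)) p - Derive f (p U) - Derive g (p V))
    - lift (phi X) p * exp (p (W 0 0)).
Proof.
  intros HX Ez Ee.
  rewrite pr2_liouville_titeica, (phiJ_uv X p HX), Ez, Ee.
  assert (Z2 : partial3 X2 (fun u _ _ => f u) = fun _ _ _ => 0)
    by (do 3 (apply functional_extensionality; intros ?); simpl; apply Derive_const).
  assert (Z3 : partial3 X3 (fun u _ _ => f u) = fun _ _ _ => 0)
    by (do 3 (apply functional_extensionality; intros ?); simpl; apply Derive_const).
  assert (E1 : partial3 X1 (fun _ v _ => g v) = fun _ _ _ => 0)
    by (do 3 (apply functional_extensionality; intros ?); simpl; apply Derive_const).
  assert (E3 : partial3 X3 (fun _ v _ => g v) = fun _ _ _ => 0)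
    by (do 3 (apply functional_extensionality; intros ?); simpl; apply Derive_const).
  assert (E2 : forall i, i <> X2 ->
            partial3 i (partial3 X2 (fun _ v _ => g v)) = fun _ _ _ => 0).
  { intros i Hi. do 3 (apply functional_extensionality; intros ?).
    destruct i; simpl; [apply Derive_const | congruence | apply Derive_const]. }
  cbv beta zeta. rewrite Z2, Z3, E1, E3, (E2 X1), (E2 X3), !partial3_zero by congruence.
  change (partial3 X1 (fun u _ _ => f u)) with (fun u _ _ : R => Derive f u).
  change (partial3 X2 (fun _ v _ => g v)) with (fun _ v _ : R => Derive g v).
  unfold lift. ring.
Qed.

Lemma symmetry_phi (X : vector_field) (f g : R -> R) (u v w : R) :
  infinitesimal_symmetry liouville_titeica X ->
  zeta X = (fun u _ _ => f u) -> eta X = (fun _ v _ => g v) ->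
  partial3 X3 (partial3 X2 (phi X)) u v w = 0 /\
  partial3 X3 (partial3 X3 (phi X)) u v w = 0 /\
  partial3 X1 (partial3 X3 (phi X)) u v w = 0 /\
  partial3 X1 (partial3 X2 (phi X)) u v w
  = exp w * (Derive f u + Derive g v + phi X u v w - partial3 X3 (phi X) u v w).
Proof.
  intros [HX H] Ez Ee.
  assert (K : forall a b,
    let L i j := partial3 i (partial3 j (phi X)) u v w in
    L X1 X2 + a * L X3 X2 + b * L X1 X3 + a * b * L X3 X3
    + exp w * (partial3 X3 (phi X) u v w - Derive f u - Derive g v)
    - phi X u v w * exp w = 0).
  { intros a b.
    assert (K : pr2 X liouville_titeica (jet_at u v w a b 0 (exp w) 0) = 0).
    { apply H. unfold liouville_titeica; simpl. ring. }
    rewrite (pr2_projectable X f g _ HX Ez Ee) in K. exact K. }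
  cbv beta zeta in K.
  (* A polynomial of degree at most 1 in each of [a] and [b] is determined by its values at these
     four points. *)
  pose proof (K 0 0). pose proof (K 1 0). pose proof (K 0 1). pose proof (K 1 1).
  repeat split; lra.
Qed.

(** * Classification of the symmetries *)

Theorem theorem9 (X : vector_field) :
  infinitesimal_symmetry liouville_titeica X <->
  exists f g : R -> R,
    smooth f /\ smooth g /\
    forall u v w : R,
      zeta X u v w = f u /\
      eta X u v w = g v /\
      phi X u v w = - (Derive f u + Derive g v).
Proof.
  split.
  - intros H. destruct (symmetry_zeta_eta X H) as [Ez Ee].
    assert (HX := H). destruct HX as [[Hz [He Hp]] _].
    pose proof (fun u v w => symmetry_phi X _ _ u v w H Ez Ee) as S.
    set (f := fun u => zeta X u 0 0) in *. set (g := fun v => eta X 0 v 0) in *.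
    exists f, g.
    split; [now apply smooth3_section1 |]. split; [now apply smooth3_section2 |].
    intros u v w. split; [now rewrite Ez |]. split; [now rewrite Ee |].
    assert (Hp3 := smooth3_partial3 X3 _ Hp). assert (Hp2 := smooth3_partial3 X2 _ Hp).
    (* Since [phi_omega_omega = 0], this slope is the same for every [omega], so [phi] is affine in
       [omega] over the fixed point [(u, v)]. *)
    set (c := partial3 X3 (phi X) u v 0).
    assert (Hc : forall w, partial3 X3 (phi X) u v w = c).
    { intros t. apply (Derive_zero_constant (fun t => partial3 X3 (phi X) u v t)); intros y;
        [apply (smooth3_ex_partial3 X3 _ u v y Hp3) | apply (S u v y)]. }
    assert (Hphi : forall w, phi X u v w = phi X u v 0 + c * w).
    { intros t.
      assert (E : phi X u v t - c * t = phi X u v 0 - c * 0); [| lra].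
      assert (D : forall y, is_derive (fun t => phi X u v t - c * t) y 0).
      { intros y. replace 0 with (partial3 X3 (phi X) u v y - c) by (rewrite Hc; ring).
        apply (is_derive_minus (V := R_NormedModule) (fun t => phi X u v t) (fun t => c * t)).
        - apply Derive_correct, (smooth3_ex_partial3 X3 _ u v y Hp).
        - auto_derive; [exact I | ring]. }
      apply (Derive_zero_constant (fun t => phi X u v t - c * t)); intros y;
        [exists 0; apply D | apply is_derive_unique, D]. }
    assert (Huv : forall w, partial3 X1 (partial3 X2 (phi X)) u v w
                            = partial3 X1 (partial3 X2 (phi X)) u v 0).
    (* The [u]-derivative sees nearby points, so [phi_v] is shown to be independent of [omega] at
       every [x], not just at [u]. *)
    { intros t. apply Derive_ext. intros x.
      apply (Derive_zero_constant (fun t => partial3 X2 (phi X) x v t)); intros y;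
        [apply (smooth3_ex_partial3 X3 _ x v y Hp2) | apply (S x v y)]. }
    (* Inserting [phi = phi(u, v, 0) + c * omega] into the last determining equation gives a
       constant equal to [exp omega] times an affine function; both coefficients vanish, which fixes
       [phi]. *)
    destruct (affine_exp_constant (Derive f u + Derive g v + phi X u v 0 - c) c
                (partial3 X1 (partial3 X2 (phi X)) u v 0)) as [Hm Hc0].
    { intros t. destruct (S u v t) as (_ & _ & _ & E).
      rewrite Huv, Hc, (Hphi t) in E. rewrite E. ring. }
    rewrite Hphi, Hc0 in *. lra.
  - intros (f & g & Hf & Hg & H).
    assert (Ez : zeta X = fun u _ _ => f u)
      by (do 3 (apply functional_extensionality; intros ?); apply H).
    assert (Ee : eta X = fun _ v _ => g v)
      by (do 3 (apply functional_extensionality; intros ?); apply H).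
    assert (Ep : phi X = fun u v _ => - Derive f u + - Derive g v).
    { do 3 (apply functional_extensionality; intros ?).
      destruct (H x x0 x1) as (_ & _ & ->). ring. }
    assert (HX : smooth_vector_field X).
    { split; [| split].
      - rewrite Ez.
        (* A zero summand brings the coefficient into separated form. *)
        replace (fun u _ _ : R => f u) with (fun u v _ : R => f u + (fun _ => 0) v)
          by (do 3 (apply functional_extensionality; intros ?); ring).
        apply smooth3_separated; [assumption | apply smooth_const].
      - rewrite Ee.
        replace (fun _ v _ : R => g v) with (fun u v _ : R => (fun _ => 0) u + g v)
          by (do 3 (apply functional_extensionality; intros ?); ring).
        apply smooth3_separated; [apply smooth_const | assumption].
      - rewrite Ep.
        apply (smooth3_separated (fun u => - Derive f u) (fun v => - Derive g v));
          now apply smooth_opp, smooth_Derive. }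
    split; [exact HX |]. intros p Hp.
    rewrite (pr2_projectable X f g p HX Ez Ee), Ep.
    assert (P3 : partial3 X3 (fun u v _ => - Derive f u + - Derive g v)
                 = fun _ _ _ => 0)
      by (do 3 (apply functional_extensionality; intros ?); simpl; apply Derive_const).
    assert (P2 : partial3 X2 (fun u v _ => - Derive f u + - Derive g v)
                 = fun _ v _ => - Derive (Derive g) v).
    { do 3 (apply functional_extensionality; intros ?).
      simpl. rewrite Derive_plus, Derive_const, Derive_opp; [ring | apply ex_derive_const |].
      now apply smooth_ex_derive, smooth_opp, smooth_Derive. }
    assert (P : forall i, i <> X2 ->
              partial3 i (fun _ v _ => - Derive (Derive g) v) = fun _ _ _ => 0).
    { intros i Hi. do 3 (apply functional_extensionality; intros ?).
      destruct i; simpl; [apply Derive_const | congruence | apply Derive_const]. }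
    cbv beta zeta. rewrite P3, P2, (P X1), (P X3), !partial3_zero by congruence.
    (* All second partials of [phi] have vanished; what remains is
       [(f' + g') * (exp omega - omega_uv)], zero on the equation. *)
    unfold liouville_titeica in Hp. unfold lift.
    replace (p (W 1 1)) with (exp (p (W 0 0))) by lra. ring.
Qed.
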